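(* For every $r\in\left(\frac12,\sin\left(\frac{3\pi}{14}\right)\right)$, $$\sup_{\mu\in\mathcal{M}(\mathbb{S}^1)}\int_{\mathbb{S}^1}\mu(I_r(x))\,d\mu(x)=\frac23.$$
   Context: $\mathbb{S}^1\subset\mathbb{R}^2$ is the unit circle centered at the origin, and $\mathcal{M}(\mathbb{S}^1)$ is the set of Borel probability measures on $\mathbb{S}^1$. For $x\ne y$ in $\mathbb{S}^1$, $\operatorname{aff}(x,y)$ is the line through $x$ and $y$; $\operatorname{aff}(x,x)$ is the tangent line to $\mathbb{S}^1$ at $x$. For $x\in\mathbb{S}^1$ and $0<r<1$, $I_r(x)=\{y\in\mathbb{S}^1:\operatorname{aff}(x,y)\cap\overline{C_r}\ne\emptyset\}$, where $\overline{C_r}$ is the closed disk of radius $r$ centered at the origin. *)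

(* Defs.v *)
From HB Require Import structures.
From mathcomp Require Import all_boot all_order all_algebra.
From mathcomp Require Import all_classical all_reals all_analysis.
Set Implicit Arguments.
Unset Strict Implicit.
Unset Printing Implicit Defensive.
Import Order.TTheory GRing.Theory Num.Theory.
Import numFieldNormedType.Exports.
Local Open Scope classical_set_scope.
Local Open Scope ring_scope.

(* The library norm on [R * R] is the max norm, hence this one. *)
Definition euclid_norm (R : realType) (p : R * R) : R :=
  Num.sqrt (p.1 ^+ 2 + p.2 ^+ 2).

Definition unit_circle (R : realType) : set (R * R) :=
  [set p | euclid_norm p = 1].

Definition closed_disk (R : realType) (r : R) : set (R * R) :=
  [set p | euclid_norm p <= r].

(* [S1 R] carries the topology induced by the product topology of [R * R]. *)
Definition S1 (R : realType) : Type := set_type (@unit_circle R).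

HB.instance Definition _ (R : realType) :=
  Topological.copy (S1 R) (set_type (@unit_circle R)).

Lemma unit_circle_point (R : realType) : (1, 0) \in @unit_circle R.
Proof. by rewrite inE /unit_circle /euclid_norm /= expr1n expr0n addr0 sqrtr1. Qed.

HB.instance Definition _ (R : realType) :=
  isPointed.Build (S1 R) (exist _ (1, 0) (unit_circle_point R)).

Definition borel_S1 (R : realType) := g_sigma_algebraType (@open (S1 R)).

Definition tangent_line (R : realType) (x : R * R) : set (R * R) :=
  [set p | (p.1 - x.1) * x.1 + (p.2 - x.2) * x.2 = 0].

Definition secant_line (R : realType) (x y : R * R) : set (R * R) :=
  [set p | exists t : R,
     p = (x.1 + t * (y.1 - x.1), x.2 + t * (y.2 - x.2))].

Definition aff (R : realType) (x y : S1 R) : set (R * R) :=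
  if x == y then tangent_line (\val x) else secant_line (\val x) (\val y).

Definition I_ (R : realType) (r : R) (x : S1 R) : set (S1 R) :=
  [set y | aff x y `&` closed_disk r !=set0].

(* Main.v *)
Require Import Defs.
From HB Require Import structures.
From mathcomp Require Import all_boot all_order all_algebra ring lra.
From mathcomp Require Import all_classical all_reals all_analysis.
From mathcomp Require Import measurable_realfun.
Import Order.TTheory GRing.Theory Num.Theory.
Import numFieldNormedType.Exports.
Local Open Scope classical_set_scope.
Local Open Scope ring_scope.

(* The line through [x] and [y] meets the disk of radius [r] exactly when
   [<x, y> <= 2 r ^ 2 - 1], a negative number since [r < sin (3 pi / 14) < sin (pi / 4)].
   Four unit vectors of the plane cannot have pairwise negative inner products, so
   the relation "[y] is in [I_r x]" contains no 4-clique, and Turan's theorem for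
   measures bounds the measure of its edges by [1 - 1/3]. As [r > 1/2], the uniform
   measure on the vertices of an equilateral triangle reaches this bound. *)

(* For symmetric [E]: no [n] points of [A] are pairwise [E]-related. *)
Fixpoint clique_free {T : Type} (E : set (T * T)) (n : nat) (A : set T) : Prop :=
  if n is n'.+1 then
    forall x, A x -> clique_free E n' (A `&` [set y | E (x, y)])
  else False.

(** * Product measures *)

Section product_measure.
Context {d1 d2 : measure_display} {T1 : measurableType d1} {T2 : measurableType d2}.
Context {R : realType}.
Local Open Scope ereal_scope.

(** Tonelli's theorem for the indicator of [W]: the two sides are its iterated integrals in the two
    orders. *)
Lemma product_measure_swap (m1 : {sigma_finite_measure set T1 -> \bar R})
    (m2 : {sigma_finite_measure set T2 -> \bar R}) (W : set (T1 * T2)) :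
  measurable W -> (m2 \x m1) ((fun z => (z.2, z.1)) @^-1` W) = (m1 \x m2) W.
Proof.
move=> mW; rewrite /product_measure1.
have := @indic_fubini_tonelli _ _ _ _ _ m1 m2 W mW.
rewrite (indic_fubini_tonelli_FE m2 mW) (indic_fubini_tonelli_GE m1 mW) => ->.
by apply: eq_integral => x _ /=; congr (m1 _); apply/seteqP; split=> y;
  rewrite /xsection /ysection/= !inE.
Qed.

Lemma fin_num_product (m1 : {finite_measure set T1 -> \bar R})
    (m2 : {finite_measure set T2 -> \bar R}) (W : set (T1 * T2)) :
  measurable W -> (m1 \x m2) W \is a fin_num.
Proof.
move=> mW; rewrite ge0_fin_numE//.
apply: (@le_lt_trans _ _ ((m1 \x m2) ([set: T1] `*` [set: T2]))).
  by apply: le_measure; rewrite ?inE// setXTT.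
by rewrite product_measure1E// ltey_eq fin_numM//; exact: fin_num_measure.
Qed.

End product_measure.

(** * Turan's theorem for a finite measure and a symmetric relation *)

Section turan.
Context {d : measure_display} {T : measurableType d} {R : realType}.
Variable mu : {finite_measure set T -> \bar R}.
Variable E : set (T * T).
Hypotheses (mE : measurable E) (symE : forall x y, E (x, y) -> E (y, x)).
Local Open Scope ereal_scope.
Implicit Types A B : set T.

Let edges A : set (T * T) := E `&` (A `*` A).
(** As a section of [edges A] rather than of [E], it is empty for [x] outside [A], so degrees can be
    integrated over the whole space. *)
Let nbh A x : set T := xsection (edges A) x.
Let deg A x : \bar R := mu (nbh A x).

Let measurable_edges A : measurable A -> measurable (edges A).
Proof. by move=> mA; apply: measurableI => //; exact: measurableX. Qed.

Let measurable_nbh A x : measurable A -> measurable (nbh A x).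
Proof. by move=> mA; apply: measurable_xsection; exact: measurable_edges. Qed.

Let measurable_deg A : measurable A -> measurable_fun [set: T] (deg A).
Proof. by move=> mA; apply: measurable_fun_xsection; exact: measurable_edges. Qed.

Let nbhE A x y : nbh A x y <-> [/\ E (x, y), A x & A y].
Proof. by rewrite /nbh /xsection/= inE; split=> [[? []]|[]]. Qed.

(* Inclusion-exclusion for the edges of [A] leaving from, respectively arriving
   in, the neighbourhood of [x]. *)
Let degree_sum_nbh A x : measurable A ->
  2%:E * \int[mu]_(y in nbh A x) deg A y <=
  (mu \x mu) (edges (nbh A x)) + (mu \x mu) (edges A).
Proof.
move=> mA; set B := nbh A x.
have mB : measurable B by exact: measurable_nbh.
have BA : B `<=` A by move=> y /nbhE[].
pose U := edges A `&` (B `*` setT); pose V := edges A `&` (setT `*` B).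
have mU : measurable U.
  by apply: measurableI; [exact: measurable_edges|exact: measurableX].
have mV : measurable V.
  by apply: measurableI; [exact: measurable_edges|exact: measurableX].
have UE : (mu \x mu) U = \int[mu]_(y in B) deg A y.
  rewrite /product_measure1 [RHS]integral_mkcond; apply: eq_integral => y _ /=.
  rewrite patchE /U xsectionI; case: ifPn => yB.
    by rewrite in_xsectionX// setIT.
  by rewrite notin_xsectionX// setI0 measure0.
have VU : (mu \x mu) V = (mu \x mu) U.
  rewrite -(product_measure_swap mu mu U)//; congr product_measure1.
  apply/seteqP; split=> -[y z] /= [[/= Eyz [/= Ay Az]] [/= Hy Hz]];
    by (repeat split) => //=; apply: symE.
have UV : (mu \x mu) (U `|` V) =
    (mu \x mu) U + (mu \x mu) V - (mu \x mu) (U `&` V).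
  by apply: measureUfinl => //; rewrite -ge0_fin_numE//; exact: fin_num_product.
have UVB : U `&` V = edges B.
  apply/seteqP; split=> -[y z].
    by move=> [[[/= Eyz _] [/= By _]] [_ [_ /= Bz]]].
  by move=> [/= Eyz [/= By Bz]]; (repeat split) => //=; exact: BA.
have UVA : (mu \x mu) (U `|` V) <= (mu \x mu) (edges A).
  apply: le_measure; rewrite ?inE; first exact: measurableU.
    exact: measurable_edges.
  by move=> z [[]|[]].
suff : 2%:E * (mu \x mu) U <= (mu \x mu) (edges B) + (mu \x mu) (edges A).
  by rewrite UE.
move: UVA; rewrite UV VU UVB.
have /fineK <- := fin_num_product mu mu _ mU.
have /fineK <- := fin_num_product mu mu _ (measurable_edges A mA).
have /fineK <- := fin_num_product mu mu _ (measurable_edges B mB).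
rewrite -!(EFinD, EFinB, EFinM) !lee_fin; lra.
Qed.

Let nbh_deg A (z : T * T) : \bar R := (\1_(edges A) z)%:E * deg A z.2.

Let nbh_deg_ge0 A z : 0 <= nbh_deg A z.
Proof. by rewrite mule_ge0// lee_fin. Qed.

Let measurable_nbh_deg A : measurable A -> measurable_fun [set: T * T] (nbh_deg A).
Proof.
move=> mA; apply: emeasurable_funM.
  by apply/measurable_EFinP; apply: measurable_indic; exact: measurable_edges.
by apply: measurableT_comp; first exact: measurable_deg.
Qed.

Let integral_nbhE A x :
  \int[mu]_(y in nbh A x) deg A y = \int[mu]_y nbh_deg A (x, y).
Proof.
rewrite integral_mkcond; apply: eq_integral => y _.
rewrite patchE /nbh mem_xsection /nbh_deg indicE.
by case: ifPn => /= _; rewrite ?mul1e ?mul0e.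
Qed.

Let measurable_integral_nbh A : measurable A ->
  measurable_fun [set: T] (fun x => \int[mu]_(y in nbh A x) deg A y).
Proof.
move=> mA; under eq_fun do rewrite integral_nbhE.
by apply: (measurable_fun_fubini_tonelli_F (nbh_deg A)) => //; exact: measurable_nbh_deg.
Qed.

(** Double counting of the paths of length two: by their first point, then by their middle point
    [y], which leaves [deg A y] choices on each side. *)
Let integral2_nbh A : measurable A ->
  \int[mu]_x \int[mu]_(y in nbh A x) deg A y = \int[mu]_x (deg A x * deg A x).
Proof.
move=> mA; under eq_integral do rewrite integral_nbhE.
rewrite fubini_tonelli//; last exact: measurable_nbh_deg.
apply: eq_integral => y _.
rewrite /nbh_deg/= ge0_integralZr//; last first.
  apply/measurable_EFinP.
  apply: (measurableT_comp (f := (\1_(edges A) : T * T -> R))).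
    by apply: measurable_indic; exact: measurable_edges.
  exact: pair2_measurable.
congr (_ * _).
have := indic_fubini_tonelli_GE mu (measurable_edges A mA) => /(congr1 (@^~ y)).
rewrite /fubini_G /= => ->; congr (mu _).
by apply/seteqP; split=> x; rewrite /nbh /xsection /ysection/= !inE => -[/symE ? []].
Qed.

Let fin_num_deg A x : measurable A -> deg A x \is a fin_num.
Proof. by move=> mA; apply: fin_num_measure; exact: measurable_nbh. Qed.

Let nbh_notin A x : ~ A x -> nbh A x = set0.
Proof. by move=> nAx; apply/seteqP; split=> // y /nbhE[]. Qed.

Let deg_le A x : measurable A -> deg A x <= mu setT.
Proof. by move=> mA; apply: le_measure; rewrite ?inE//; exact: measurable_nbh. Qed.

(** Degrees are bounded by the finite total mass; naming the integral as a real number lets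
    [edges_le] end in real arithmetic. *)
Let sq_deg A : measurable A -> exists q : R, \int[mu]_x (deg A x * deg A x) = q%:E.
Proof.
move=> mA; exists (fine (\int[mu]_x (deg A x * deg A x))); rewrite fineK//.
rewrite ge0_fin_numE; last by apply: integral_ge0 => x _; rewrite mule_ge0.
apply: (@le_lt_trans _ _ (\int[mu]_x (cst (mu setT * mu setT) x))).
  apply: ge0_le_integral => //.
  - by move=> x _; rewrite mule_ge0.
  - by apply: emeasurable_funM; exact: measurable_deg.
  - by move=> x _; apply: lee_pmul => //; exact: deg_le.
by rewrite integral_cst// ltey_eq !fin_numM//; exact: fin_num_measure.
Qed.

(* Averaging [degree_sum_nbh] over [x] in [A] gives [(2 - c) q <= m p], where [p]
   is the measure of the edges in [A], [q] the integral of the squared degree and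
   [m] the measure of [A]; Cauchy-Schwarz in the form [2 t p <= q + t ^ 2 m]
   at [t = m / (2 - c)] then bounds [p]. *)
Let edges_le A (c : R) : measurable A -> (0 <= c < 2)%R ->
  (forall x, A x -> (mu \x mu) (edges (nbh A x)) <= c%:E * (deg A x * deg A x)) ->
  (mu \x mu) (edges A) <= ((2 - c)^-1 * fine (mu A) ^+ 2)%:E.
Proof.
move=> mA /andP[c0 c2] nbh_le.
have [q qE] := sq_deg A mA.
set p := fine ((mu \x mu) (edges A)).
have pE : (mu \x mu) (edges A) = p%:E.
  by rewrite fineK// fin_num_product//; exact: measurable_edges.
set m := fine (mu A).
have mE' : mu A = m%:E by rewrite fineK// fin_num_measure.
have m0 : (0 <= m)%R by rewrite fine_ge0.
have p0 : (0 <= p)%R by rewrite fine_ge0.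
have mdegq : measurable_fun [set: T] (fun x => deg A x * deg A x).
  by apply: emeasurable_funM; exact: measurable_deg.
have m1A (u : R) : measurable_fun [set: T] (fun x => u%:E * (\1_A x)%:E).
  by apply/measurable_funeM/measurable_EFinP; exact: measurable_indic.
have int1A (u : R) : (0 <= u)%R -> \int[mu]_x (u%:E * (\1_A x)%:E) = (u * m)%:E.
  move=> u0; rewrite ge0_integralZl//.
  - by rewrite integral_indic// setIT EFinM -mE'.
  - by apply/measurable_EFinP; exact: measurable_indic.
have avg : (2 * q <= c * q + p * m)%R.
  rewrite -lee_fin EFinD !EFinM -qE -EFinM -int1A//.
  rewrite -[X in X + _]ge0_integralZl//; last by move=> x _; rewrite mule_ge0.
  rewrite -ge0_integralD//; first last.
  - by move=> x _; rewrite mule_ge0// lee_fin.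
  - exact: measurable_funeM.
  - by move=> x _; rewrite !mule_ge0.
  rewrite -integral2_nbh// -ge0_integralZl//; first last.
  - by move=> x _; apply: integral_ge0.
  - exact: measurable_integral_nbh.
  apply: ge0_le_integral => //.
  - by move=> x _; rewrite mule_ge0// integral_ge0.
  - by apply: measurable_funeM; exact: measurable_integral_nbh.
  - by apply: emeasurable_funD => //; exact: measurable_funeM.
  move=> x _; rewrite indicE; have [xA|xA] := boolP (x \in A).
    rewrite mule1 -pE (le_trans (degree_sum_nbh _ x mA))// leeD2r//.
    by apply: nbh_le; rewrite inE in xA.
  rewrite notin_setE in xA; rewrite nbh_notin// integral_set0 mule0.
  by rewrite adde_ge0// ?mule_ge0// lee_fin.
have cs (t : R) : (0 <= t)%R -> (2 * t * p <= q + t ^+ 2 * m)%R.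
  move=> t0.
  rewrite -lee_fin EFinD EFinM -pE -qE -int1A ?sqr_ge0//.
  rewrite -ge0_integralD//; first last.
  - by move=> x _; rewrite mule_ge0// lee_fin ?sqr_ge0.
  - by move=> x _; rewrite mule_ge0.
  rewrite /product_measure1 -ge0_integralZl//; last 2 first.
  - exact: measurable_deg.
  - by rewrite lee_fin mulr_ge0.
  apply: ge0_le_integral => //.
  - by move=> x _; rewrite mule_ge0// lee_fin mulr_ge0.
  - by apply: measurable_funeM; exact: measurable_deg.
  - exact: emeasurable_funD.
  (* On [A] the pointwise inequality is [0 <= (deg A x - t) ^ 2]; off [A] the degree is zero. *)
  move=> x _; rewrite indicE/= -/(deg A x); have [xA|xA] := boolP (x \in A).
    have /fineK <- := fin_num_deg A x mA.
    rewrite -!(EFinM, EFinD) lee_fin; set f := fine _.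
    by rewrite mulr1; have := sqr_ge0 (f - t); nra.
  by rewrite notin_setE in xA; rewrite /deg nbh_notin// measure0 !mule0 adde0.
have s0 : (0 < 2 - c)%R by lra.
rewrite pE lee_fin.
(* If [m = 0], the choice [t = m / (2 - c)] is zero and says nothing about [p]; [t = 1] gives
   [2 p <= q], while [avg] gives [q <= 0]. *)
have [m_eq0|m_neq0] := eqVneq m 0%R.
  have := cs 1%R ler01; move: avg; rewrite m_eq0 expr1n expr0n !mulr0 !addr0 => avg.
  have q_le0 : (q <= 0)%R by rewrite -(pmulr_rle0 _ s0); lra.
  lra.
have m_gt0 : (0 < m)%R by rewrite lt_def m_neq0.
have := cs (m / (2 - c))%R (divr_ge0 m0 (ltW s0)).
set u := (m / (2 - c))%R => cst.
have uE : (u * (2 - c) = m)%R by rewrite /u divfK// gt_eqF.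
have u_gt0 : (0 < u)%R by rewrite divr_gt0.
suff : (p <= u * m)%R by rewrite /u expr2 mulrA [(_^-1 * m)%R]mulrC.
(* As [m = u (2 - c)], [avg] amounts to [q <= u p], and [cst] then yields [u p <= u ^ 2 m]. *)
rewrite -(ler_pM2r u_gt0) -(ler_pM2r s0); nra.
Qed.

(** Induction on [k]: the neighbourhood of a point of [A] contains no clique of one point fewer, so
    [edges_le] applies with [c = k / (k + 1)], and [1 / (2 - c) = (k + 1) / (k + 2)]. For [k = 0] a
    single edge would be a 2-clique. *)
Lemma measure_turan k A : measurable A -> clique_free E k.+2 A ->
  (mu \x mu) (E `&` (A `*` A)) <= (k%:R / k.+1%:R * fine (mu A) ^+ 2)%:E.
Proof.
rewrite -/(edges A); elim: k A => [|k IHk] A mA cfA.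
  suff -> : edges A = set0 by rewrite measure0 mul0r mul0r.
  apply/seteqP; split=> // -[x y] [/= Exy [/= Ax Ay]].
  exact: (cfA x Ax y (conj Ay Exy)).
have -> : (k.+1%:R / k.+2%:R = (2 - k%:R / k.+1%:R)^-1 :> R)%R.
  rewrite -!natr1; field.
  by have := ler0n R k => k0; apply/andP; split; rewrite gt_eqF//; lra.
apply: edges_le => //.
  rewrite divr_ge0//= ltr_pdivrMr// -natr1; have := ler0n R k; lra.
move=> x Ax.
rewrite -(fineK (fin_num_deg A x mA)) -!EFinM -expr2.
apply: IHk; first exact: measurable_nbh.
have -> : nbh A x = A `&` [set y | E (x, y)].
  by apply/seteqP; split=> y; [move=> /nbhE[]|move=> -[Ay Exy]; apply/nbhE].
exact: cfA.
Qed.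

End turan.

(** * Chords and inner products on the unit circle *)

Section circle.
Context {R : realType}.
Implicit Types x y z : S1 R.

Definition dot x y : R :=
  (\val x).1 * (\val y).1 + (\val x).2 * (\val y).2.

Lemma dotC x y : dot x y = dot y x.
Proof. by rewrite /dot mulrC [X in _ + X]mulrC. Qed.

Lemma S1_sqr x : (\val x).1 ^+ 2 + (\val x).2 ^+ 2 = 1.
Proof.
have := valP x; rewrite inE /unit_circle/euclid_norm /= => h.
rewrite -[LHS]sqr_sqrtr ?addr_ge0 ?sqr_ge0//.
by transitivity ((1 : R) ^+ 2); [congr (_ ^+ 2)|exact: expr1n].
Qed.

Lemma closed_diskE (r : R) (p : R * R) : 0 <= r ->
  closed_disk r p <-> p.1 ^+ 2 + p.2 ^+ 2 <= r ^+ 2.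
Proof.
move=> r0; rewrite /closed_disk/euclid_norm/=.
by rewrite -{1}(ger0_norm r0) -sqrtr_sqr ler_sqrt// sqr_ge0.
Qed.

(* The point of the chord closest to the origin is its midpoint, at squared
   distance [(1 + <x, y>) / 2]. *)
Lemma I_E (r : R) x y : 0 <= r < 1 -> I_ r x y <-> dot x y <= 2 * r ^+ 2 - 1.
Proof.
move=> /andP[r0 r1]; rewrite /I_/= /aff.
have := S1_sqr x; have := S1_sqr y; rewrite /dot.
have [<-|xy] := eqVneq x y.
  (* Both sides fail when [x = y]: the tangent is at distance 1 from the origin, and [dot x x = 1]
     exceeds [2 r ^ 2 - 1]. *)
  move: (\val x) => [a b]/= _ ab.
  have r2 : r ^+ 2 < 1 by nra.
  split; last by move=> h; exfalso; nra.
  move=> [[p q] [/= tg /closed_diskE -/(_ r0)/= pq]].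
  (* Lagrange's identity: on the tangent the first square is 1, which bounds the norm from below. *)
  have lag : (p * a + q * b) ^+ 2 + (p * b - q * a) ^+ 2 = p ^+ 2 + q ^+ 2.
    by rewrite -[RHS]mulr1 -ab; ring.
  have paqb : p * a + q * b = 1 by move: tg; rewrite /tangent_line/=; lra.
  have := sqr_ge0 (p * b - q * a); rewrite paqb expr1n in lag; lra.
move: (\val x) (\val y) => [a b] [c d]/= cd ab.
set D := a * c + b * d.
have seg t : (a + t * (c - a)) ^+ 2 + (b + t * (d - b)) ^+ 2 =
    (1 + D) / 2 + (2 * t - 1) ^+ 2 * (1 - D) / 2.
  transitivity ((1 - t) ^+ 2 * (a ^+ 2 + b ^+ 2) + t ^+ 2 * (c ^+ 2 + d ^+ 2)
    + 2 * t * (1 - t) * D); first by rewrite /D; ring.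
  by rewrite ab cd; field.
split.
  move=> [_ [[t ->] /closed_diskE -/(_ r0)/=]]; rewrite seg.
  have D1 : 0 <= 1 - D.
    by have := sqr_ge0 (a - c); have := sqr_ge0 (b - d); rewrite /D; nra.
  have := mulr_ge0 (sqr_ge0 (2 * t - 1)) D1; lra.
move=> le; exists (a + 2^-1 * (c - a), b + 2^-1 * (d - b)); split.
  by exists 2^-1.
apply/closed_diskE => //=; rewrite seg divff// subrr expr0n mul0r; lra.
Qed.

(* In the frame of [x] the points [y], [z] and [w] have negative abscissa, and
   two of their ordinates have the same sign: these two make an acute angle. *)
Lemma clique_free_obtuse (E : set (S1 R * S1 R)) :
  (forall x y, E (x, y) -> dot x y < 0) -> clique_free E 4 setT.
Proof.
move=> E0 x _ y [_ /E0 xy] z [[_ /E0 xz] /E0 yz] w [[[_ /E0 xw] /E0 yw] /E0 zw].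
pose det (u v : S1 R) : R := (\val u).1 * (\val v).2 - (\val u).2 * (\val v).1.
(* The inner product in the orthonormal frame formed by [x] and its rotation by a right angle. *)
have frame (u v : S1 R) : dot u v = dot x u * dot x v + det x u * det x v.
  rewrite -[LHS]mul1r -(S1_sqr x) /dot /det; ring.
rewrite frame in yz; rewrite frame in yw; rewrite frame in zw.
have [yz0 yw0 zw0] : [/\ det x y * det x z < 0, det x y * det x w < 0 &
  det x z * det x w < 0] by split; nra.
have [y0|y0] := leP 0 (det x y); have [z0|z0] := leP 0 (det x z);
  have [w0|w0] := leP 0 (det x w); nra.
Qed.

Lemma measurable_val (f : R * R -> R) : continuous f ->
  measurable_fun [set: borel_S1 R] (fun x : borel_S1 R => f (\val (x : S1 R))).
Proof.
move=> cf; apply: (measurability _ (RGenOpens.measurableE R)).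
move=> _ [_ [a [b ->] <-]]; rewrite setTI; apply: sub_sigma_algebra.
(* Open sets of the circle are the traces of open sets of the plane, so an open preimage in the
   plane suffices. *)
by exists (f @^-1` `]a, b[) => //; move/continuousP: cf; apply; exact: interval_open.
Qed.

End circle.

(** * The upper bound, and the equilateral triangle attaining it *)

Section triangle.
Context {R : realType}.

(** At [c = 2 r ^ 2 - 1] this is the relation of lying in [I_ r x]; the angles are obtuse once
    [c < 0]. *)
Definition obtuse_pairs (c : R) : set (borel_S1 R * borel_S1 R) :=
  [set z | dot (z.1 : S1 R) (z.2 : S1 R) <= c].

Lemma measurable_obtuse_pairs c : measurable (obtuse_pairs c).
Proof.
have m1 : measurable_fun [set: borel_S1 R] (fun x : borel_S1 R => (\val (x : S1 R)).1).
  by apply: (measurable_val fst) => x; exact: cvg_fst.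
have m2 : measurable_fun [set: borel_S1 R] (fun x : borel_S1 R => (\val (x : S1 R)).2).
  by apply: (measurable_val snd) => x; exact: cvg_snd.
have mdot : measurable_fun [set: borel_S1 R * borel_S1 R]
    (fun z => dot (z.1 : S1 R) (z.2 : S1 R)).
  apply: measurable_funD; apply: measurable_funM.
  - exact: (measurableT_comp m1 measurable_fst).
  - exact: (measurableT_comp m1 measurable_snd).
  - exact: (measurableT_comp m2 measurable_fst).
  - exact: (measurableT_comp m2 measurable_snd).
have := mdot measurableT _ (measurable_itv `]-oo, c]).
by rewrite setTI; congr (measurable _); apply/seteqP; split=> z; rewrite /= in_itv.
Qed.

Lemma xsection_obtuse_pairs (r : R) (x : S1 R) : 0 <= r < 1 ->
  xsection (obtuse_pairs (2 * r ^+ 2 - 1)) x = I_ r x.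
Proof.
move=> r01; apply/seteqP; split=> y; rewrite /xsection/= inE => h; exact/I_E.
Qed.

Lemma integral_I_le (r : R) (mu : probability (borel_S1 R) R) :
  0 <= r -> r ^+ 2 < 2^-1 ->
  (\int[mu]_(x in [set: borel_S1 R]) mu (I_ r x) <= (2 / 3)%:E)%E.
Proof.
move=> r0 r2; set E := obtuse_pairs (2 * r ^+ 2 - 1).
have r01 : 0 <= r < 1 by rewrite r0/=; nra.
have symE x y : E (x, y) -> E (y, x) by rewrite /E /obtuse_pairs/= dotC.
have cfE : clique_free E 4 setT.
  by apply: clique_free_obtuse => x y; rewrite /E /obtuse_pairs/= => ?; lra.
(* Excluding 4-cliques is the case [k = 2], whence the factor [2 / 3]; the total mass is 1. *)
have := measure_turan mu E (measurable_obtuse_pairs _) symE 2 setT measurableT cfE.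
rewrite setXTT setIT /product_measure1/= probability_setT/= expr1n mulr1.
by under eq_integral do rewrite xsection_obtuse_pairs//.
Qed.

(** The cube roots of unity. Every index from 2 on gives the third one, which makes the family total
    on [nat], as [msum] expects. *)
Definition triangle (i : nat) : R * R :=
  if i == 0%N then (1, 0) else
  if i == 1%N then (- 2^-1, Num.sqrt 3 / 2) else (- 2^-1, - (Num.sqrt 3 / 2)).

Lemma triangle_S1 i : triangle i \in @unit_circle R.
Proof.
have h3 : Num.sqrt (3 : R) ^+ 2 = 3 by rewrite sqr_sqrtr.
rewrite inE /unit_circle /= /euclid_norm -[RHS]sqrtr1; congr Num.sqrt.
by rewrite /triangle; case: ifP => _ /=; [|case: ifP => _ /=]; nra.
Qed.

Definition triangle_vertex (i : nat) : borel_S1 R :=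
  exist (fun p => p \in @unit_circle R) (triangle i) (triangle_S1 i).

(** Distinct vertices have inner product [- 1 / 2], which is at most [2 r ^ 2 - 1] exactly because
    [r >= 1 / 2]; equal ones have inner product 1. *)
Lemma I_triangle (r : R) (i j : nat) : 2^-1 <= r < 1 -> (i < 3)%N -> (j < 3)%N ->
  (triangle_vertex j \in I_ r (triangle_vertex i : S1 R)) = (i != j).
Proof.
move=> /andP[r2 r1] i3 j3.
have r01 : 0 <= r < 1 by apply/andP; split => //; lra.
have h3 : Num.sqrt (3 : R) ^+ 2 = 3 by rewrite sqr_sqrtr.
have dotE : dot (triangle_vertex i : S1 R) (triangle_vertex j : S1 R) =
    if i == j then 1 else - 2^-1.
  rewrite /dot/=; move: i j i3 j3 => [|[|[|i]]] [|[|[|j]]] // _ _;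
    by rewrite /triangle/=; nra.
apply/idP/idP; rewrite inE I_E// dotE; case: eqVneq => //= _; nra.
Qed.

Definition uniform_triangle := mscale (3^-1 : R)%:nng
  (msum (fun i => dirac (triangle_vertex i) : {measure set _ -> \bar R}) 3).

Let uniform_triangleE A : uniform_triangle A = (3^-1%:E * (\d_(triangle_vertex 0%N) A +
  \d_(triangle_vertex 1%N) A + \d_(triangle_vertex 2%N) A))%E.
Proof.
rewrite /uniform_triangle /mscale; congr (_ * _)%E.
by rewrite /= /msum big_ord_recr big_ord_recr big_ord_recr big_ord0 /= add0e.
Qed.

Let uniform_triangleT : uniform_triangle setT = 1%E.
Proof. by rewrite uniform_triangleE !diracT -!EFinD -EFinM; congr EFin; field. Qed.

HB.instance Definition _ := Measure.on uniform_triangle.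
HB.instance Definition _ :=
  Measure_isProbability.Build _ _ _ uniform_triangle uniform_triangleT.

(** From each vertex, [I_ r] contains precisely the two other vertices, of total mass [2 / 3]. *)
Lemma integral_I_triangle (r : R) : 2^-1 <= r < 1 ->
  exists mu : probability (borel_S1 R) R,
  (\int[mu]_(x in [set: borel_S1 R]) mu (I_ r x) = (2 / 3)%:E)%E.
Proof.
move=> r21; have /andP[r2 r1] := r21.
have r01 : 0 <= r < 1 by apply/andP; split => //; lra.
exists uniform_triangle.
pose f (x : borel_S1 R) : \bar R := uniform_triangle (I_ r x).
have mf : measurable_fun [set: borel_S1 R] f.
  rewrite (_ : f = uniform_triangle \o xsection (obtuse_pairs (2 * r ^+ 2 - 1))).
    by apply: measurable_fun_xsection; exact: measurable_obtuse_pairs.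
  by apply/funext => x; rewrite /= xsection_obtuse_pairs.
have fE i : (i < 3)%N -> f (triangle_vertex i) = (2 / 3)%:E.
  move=> i3; rewrite /f uniform_triangleE !diracE !I_triangle//.
  rewrite -!EFinD -EFinM; congr EFin.
  by move: i i3 => [|[|[|i]]] // _ /=; rewrite ?eqxx /=; field.
transitivity (\int[uniform_triangle]_x f x)%E; first by [].
rewrite ge0_integral_mscale//= ge0_integral_measure_sum//.
rewrite !big_ord_recr big_ord0/= add0e !integral_dirac// !diracT !mul1e !fE//.
by rewrite -!EFinD -EFinM; congr EFin; field.
Qed.

End triangle.

Theorem proposition3p5 (R : realType) (r : R)
  (r_gt : 1 / 2 < r) (r_lt : r < sin (3 * pi / 14)) :
  ereal_sup (range (fun mu : probability (borel_S1 R) R =>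
    (\int[mu]_(x in [set: borel_S1 R]) mu (I_ r x))%E)) = (2 / 3)%:E.
Proof.
have sin2 : sin (3 * pi / 14) ^+ 2 < 2^-1 :> R.
  (* The doubled angle [3 pi / 7] is below [pi / 2], so its cosine [1 - 2 sin ^ 2] is positive. *)
  have : 0 < cos ((3 * pi / 14) *+ 2) :> R.
    by apply: cos_gt0_pihalf; have := pi_gt0 R; lra.
  by rewrite cos_mulr2n cos2sin2; lra.
have r0 : 0 <= r by lra.
have r2 : r ^+ 2 < 2^-1 by apply: le_lt_trans sin2; rewrite ler_pXn2r// ?nnegrE; lra.
apply/eqP; rewrite eq_le; apply/andP; split.
  by apply: ge_ereal_sup => _ [mu _ <-]; exact: integral_I_le.
have [|mu <-] := @integral_I_triangle R r; first by apply/andP; split; nra.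
by apply: ereal_sup_ubound; exists mu.
Qed.
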